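(* Let $k$ be an integer with $1\le k\le\min\{L,\lfloor(\overline{C}-\overline{V})/V\rfloor+2\}$ and let $t\in[k,T-1]_{\mathbb{Z}}$. Then the inequality $$x_t\le\overline{V}y_t+(\overline{C}-\overline{V})(y_{t+1}-u_{t+1})-\sum_{s=1}^{k-1}\bigl(\overline{C}-\overline{V}-(s-1)V\bigr)u_{t-s+1}$$ is valid for $\mathrm{conv}(P)$. Furthermore, it is facet-defining for $\mathrm{conv}(P)$ when one of the following conditions is satisfied: (1) $L\le3$ and $k=\min\{L,\lfloor(\overline{C}-\overline{V})/V\rfloor+2\}$, for all $t\in[k,T-1]_{\mathbb{Z}}$; (2) $L\ge4$ and $k=\min\{L,\lfloor(\overline{C}-\overline{V})/V\rfloor+2\}$, for $t=T-1$.
   Context: $T$ is the number of time periods, $L,\ell$ are positive integers (minimum-up and minimum-down time) with $T\ge L+1$, and $\underline{C},\overline{C},\overline{V},V$ are real parameters (generation lower bound, generation upper bound, start-up/shut-down ramp rate, ramp rate in the stable region) with $0\le\underline{C}\le\overline{V}\le\overline{C}$ and $V>0$. For integers $a,b$, $[a,b]_{\mathbb{Z}}$ is the set of integers $i$ with $a\le i\le b$. $P$ is the set of $(x,y,u)\in\mathbb{R}_+^T\times\{0,1\}^T\times\{0,1\}^{T-1}$, with $x=(x_1,\dots,x_T)$, $y=(y_1,\dots,y_T)$, $u=(u_2,\dots,u_T)$, such that \begin{align*} &\textstyle\sum_{i=t-L+1}^{t}u_i\le y_t,\ t\in[L+1,T]_{\mathbb{Z}};\qquad \sum_{i=t-\ell+1}^{t}u_i\le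 1-y_{t-\ell},\ t\in[\ell+1,T]_{\mathbb{Z}};\\ &y_t-y_{t-1}-u_t\le 0,\ t\in[2,T]_{\mathbb{Z}};\qquad \underline{C}y_t\le x_t\le\overline{C}y_t,\ t\in[1,T]_{\mathbb{Z}};\\ &x_t-x_{t-1}\le Vy_{t-1}+\overline{V}(1-y_{t-1}),\ t\in[2,T]_{\mathbb{Z}};\qquad x_{t-1}-x_t\le Vy_t+\overline{V}(1-y_t),\ t\in[2,T]_{\mathbb{Z}}. \end{align*} $\mathrm{conv}(P)$ denotes the convex hull of $P$. Empty sums are $0$.
   Formalization: Added: ℓ+1 ≤ T or V̄ = C̄ throughout (otherwise the all-on point at capacity with u_{t+1}=1 violates the inequality), and C̲ < C̄ for the facet claim (if C̲ = C̄, the inequality is an equality on all of conv(P)). *)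

(* Defs.v *)
From mathcomp Require Import all_boot all_order all_algebra.
From mathcomp Require Import boolp classical_sets reals.

Set Implicit Arguments.
Unset Strict Implicit.
Unset Printing Implicit Defensive.

Import Order.TTheory GRing.Theory Num.Theory.

Local Open Scope classical_set_scope.
Local Open Scope ring_scope.

Section Polyhedral.
Variables (R : realType) (E : lmodType R).
Implicit Types (S C : set E) (f g : E -> R).

Definition conv_hull S : set E :=
  [set z | exists (m : nat) (c : 'I_m -> R) (p : 'I_m -> E),
      [/\ forall i, S (p i), forall i, 0 <= c i, \sum_i c i = 1
        & z = \sum_i c i *: p i]].

Definition affinely_independent (m : nat) (p : 'I_m -> E) : Prop :=
  forall c : 'I_m -> R,
    \sum_i c i = 0 -> \sum_i c i *: p i = 0 -> forall i, c i = 0.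

(* The affine hull of S has dimension d: d + 1 is the largest number of
   affinely independent points of S. In particular S is nonempty. *)
Definition affine_dim S (d : nat) : Prop :=
  (exists p : 'I_d.+1 -> E, (forall i, S (p i)) /\ affinely_independent p) /\
  (forall (m : nat) (p : 'I_m -> E),
      (forall i, S (p i)) -> affinely_independent p -> (m <= d.+1)%N).

(* The next two definitions are about the inequality f z <= g z, where f and g
   are meant to be affine functions. *)
Definition valid_ineq C f g : Prop := forall z, C z -> f z <= g z.

Definition facet_defining C f g : Prop :=
  valid_ineq C f g /\
  exists d : nat,
    affine_dim (C `&` [set z | f z = g z]) d /\ affine_dim C d.+1.

End Polyhedral.

Section UnitCommitment.
Variables (R : realType) (T : nat).

Definition point : lmodType R := ('rV[R]_T * 'rV[R]_T * 'rV[R]_T.-1)%type.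

(* Entry number i, counted from 0, of a row vector; 0 when i is out of range. *)
Definition entry (n : nat) (v : 'rV[R]_n) (i : nat) : R :=
  oapp (fun j : 'I_n => v ord0 j) 0 (insub i).

(* Periods are numbered from 1 as in x = (x_1, .., x_T), y = (y_1, .., y_T) and
   u = (u_2, .., u_T): xc z t and yc z t are only meaningful for 1 <= t <= T,
   and uc z t for 2 <= t <= T. *)
Definition xc (z : point) (t : nat) : R := entry z.1.1 (t - 1).
Definition yc (z : point) (t : nat) : R := entry z.1.2 (t - 1).
Definition uc (z : point) (t : nat) : R := entry z.2 (t - 2).

(* L, l: minimum up and down times; Cl, Cu: generation lower and upper bounds;
   Vb: start-up/shut-down ramp rate; V: ramp rate in the stable region. *)
Variables (L l : nat) (Cl Cu Vb V : R).

Definition P : set point := [set z |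
  (forall t, (1 <= t <= T)%N -> 0 <= xc z t) /\
  (forall t, (1 <= t <= T)%N -> yc z t = 0 \/ yc z t = 1) /\
  (forall t, (2 <= t <= T)%N -> uc z t = 0 \/ uc z t = 1) /\
  (forall t, (L + 1 <= t <= T)%N ->
     \sum_(t - L + 1 <= i < t.+1) uc z i <= yc z t) /\
  (forall t, (l + 1 <= t <= T)%N ->
     \sum_(t - l + 1 <= i < t.+1) uc z i <= 1 - yc z (t - l)) /\
  (forall t, (2 <= t <= T)%N -> yc z t - yc z (t - 1) - uc z t <= 0) /\
  (forall t, (1 <= t <= T)%N -> Cl * yc z t <= xc z t <= Cu * yc z t) /\
  (forall t, (2 <= t <= T)%N ->
     xc z t - xc z (t - 1) <= V * yc z (t - 1) + Vb * (1 - yc z (t - 1))) /\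
  (forall t, (2 <= t <= T)%N ->
     xc z (t - 1) - xc z t <= V * yc z t + Vb * (1 - yc z t))].

Definition kmax : int := Num.min L%:Z (Num.floor ((Cu - Vb) / V) + 2).

Definition ineq_rhs (k t : nat) (z : point) : R :=
  Vb * yc z t + (Cu - Vb) * (yc z (t + 1) - uc z (t + 1))
  - \sum_(1 <= s < k) (Cu - Vb - (s%:R - 1) * V) * uc z (t - s + 1).

End UnitCommitment.

(* Main.v *)
(* Validity is checked on P. If y_t = y_(t+1) = 1, the minimum up time allows at
   most one start-up in the window, and after a start-up at t - s + 1 the ramp
   constraints give x_t <= Vb + (s - 1) V.

   For the facet, it suffices that an affine function vanishing on the face and
   at one point z0 of P off the face is zero: then, as long as p_1, .., p_m are
   fewer than the dimension, some nonzero affine function kills z0 and all p_i,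
   hence does not vanish on the whole face, and provides a further affinely
   independent point of the face.
   All test points have the unit on during a single run s, .., e. Lowering one
   x_i in the all-on point at capacity kills the coefficient of x_i; comparing
   runs that end at e - 1 and at e kills that of y_e; what remains of a run
   starting at s is the coefficient of u_s. For e >= t + 2 one needs a common
   start s for which both runs can be placed on the face; this is where L <= 3
   or t = T - 1 is used. *)

Require Import Defs.
From HB Require Import structures.
From mathcomp Require Import all_boot all_order all_algebra.
From mathcomp Require Import boolp classical_sets reals.
From mathcomp Require Import zify ring lra.

Import Order.TTheory GRing.Theory Num.Theory.

Local Open Scope classical_set_scope.
Local Open Scope ring_scope.

Set Implicit Arguments.
Unset Strict Implicit.
Unset Printing Implicit Defensive.

(** * Affine independence, dimension and a criterion for facets *)

Section Facets.
Variables (R : realType) (E : lmodType R).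
Implicit Types (S C : set E) (f : E -> R).

Lemma scalar_sum f (m : nat) (c : 'I_m -> R) (p : 'I_m -> E) :
  scalar f -> f (\sum_i c i *: p i) = \sum_i c i * f (p i).
Proof.
move=> fS; have f0 : f 0 = 0.
  by have := fS (- 1) 0 0; rewrite scaler0 addr0 => ->; ring.
elim/big_rec2: _ => [//|i y x _ <-]; exact: fS.
Qed.

Lemma conv_hull_sub S : S `<=` conv_hull S.
Proof.
move=> z Sz; exists 1%N, (fun=> 1), (fun=> z).
by split => //; rewrite big_ord1 ?scale1r.
Qed.

Lemma conv_hull_ge0 S f : scalar f -> (forall z, S z -> 0 <= f z) ->
  forall z, conv_hull S z -> 0 <= f z.
Proof.
move=> fS f_ge0 z [m [c [p [Sp c_ge0 _ ->]]]].
by rewrite scalar_sum //; apply: sumr_ge0 => i _; rewrite mulr_ge0 ?f_ge0.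
Qed.

Definition cons_family {X : Type} (z : X) (m : nat) (p : 'I_m -> X) : 'I_m.+1 -> X :=
  fun i => oapp p z (unlift ord0 i).

Lemma cons_family0 (X : Type) (z : X) m (p : 'I_m -> X) :
  cons_family z p ord0 = z.
Proof. by rewrite /cons_family unlift_none. Qed.

Lemma cons_familyS (X : Type) (z : X) m (p : 'I_m -> X) i :
  cons_family z p (lift ord0 i) = p i.
Proof. by rewrite /cons_family liftK. Qed.

Lemma cons_family_ind (X : Type) (Q : set X) (z : X) m (p : 'I_m -> X) :
  Q z -> (forall i, Q (p i)) -> forall i, Q (cons_family z p i).
Proof.
by move=> Qz Qp i; case: (unliftP ord0 i) => [j|] ->;
  rewrite ?cons_family0 ?cons_familyS.
Qed.

(** Apply the affine function [alpha + f] to a relation: only the term of [z] survives, so its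
    coefficient is 0 and the rest is a relation among the [p i]. *)
Lemma affinely_independent_cons (m : nat) (p : 'I_m -> E) (z : E) f (alpha : R) :
  scalar f -> affinely_independent p ->
  (forall i, alpha + f (p i) = 0) -> alpha + f z <> 0 ->
  affinely_independent (cons_family z p).
Proof.
move=> fS p_indep fp fz c sum_c sum_cp.
have psi0 : \sum_i c i * (alpha + f (cons_family z p i)) = 0.
  under eq_bigr do rewrite mulrDr.
  rewrite big_split /= -mulr_suml sum_c mul0r add0r -scalar_sum // sum_cp.
  by have := fS (- 1) 0 0; rewrite scaler0 addr0 => ->; ring.
move: psi0 sum_c sum_cp; rewrite !big_ord_recl cons_family0.
under eq_bigr do rewrite cons_familyS fp mulr0.
under [X in _ -> _ -> _ + X = _ -> _]eq_bigr do rewrite cons_familyS.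
rewrite big1 // addr0 => /eqP; rewrite mulf_eq0 => /orP[/eqP c0|/eqP//].
rewrite c0 scale0r !add0r => sum_c sum_cp i.
case: (unliftP ord0 i) => [j|] -> //; exact: p_indep sum_cp j.
Qed.

Section Coordinates.
Variables (n : nat) (g : {linear E -> 'rV[R]_n}).

(** The leading 1 turns affine relations and affine functions into linear ones. *)
Definition homogenize (z : E) : 'rV[R]_(1 + n) := row_mx 1 (g z).

Lemma indep_points (S : set E) (z0 : E) :
  (forall (alpha : R) (w : 'cV[R]_n), alpha + (g z0 *m w) 0 0 = 0 ->
     (forall z, S z -> alpha + (g z *m w) 0 0 = 0) -> alpha = 0 /\ w = 0) ->
  forall m, (m <= n)%N ->
  exists p : 'I_m -> E, (forall i, S (p i)) /\ affinely_independent p.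
Proof.
move=> ann; elim => [_|m IHm lt_mn].
  by exists (fun=> z0); split => [[]|c _ _ []].
have [p [Sp p_indep]] := IHm (ltnW lt_mn).
pose M : 'M_(m.+1, 1 + n) := \matrix_i homogenize (cons_family z0 p i).
(* The m + 1 rows of [M] live in dimension 1 + n with m < n, so a nonzero [v] kills them all. It is
   read as the affine function with constant [alpha] and linear part [w]. *)
have : kermx M^T != 0.
  rewrite -mxrank_eq0 mxrank_ker mxrank_tr subn_eq0 -ltnNge.
  by rewrite (leq_ltn_trans (rank_leq_row M)).
case/rowV0Pn => v /sub_kermxP vM v_neq0.
pose alpha := v 0 (lshift n ord0); pose w : 'cV_n := (rsubmx v)^T.
have psiE z : (homogenize z *m v^T) 0 0 = alpha + (g z *m w) 0 0.
  rewrite -[v in LHS]hsubmxK tr_row_mx mul_row_col mul1mx !mxE.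
  by congr (v 0 _ + _).
have psiM i : alpha + (g (cons_family z0 p i) *m w) 0 0 = 0.
  rewrite -psiE; have := congr1 (fun A => A^T i 0) vM.
  rewrite trmx_mul trmxK trmx0 [RHS]mxE => <-.
  by rewrite !mxE; apply: eq_bigr => j _; rewrite !mxE.
have [z Sz psi_z] : exists2 z, S z & alpha + (g z *m w) 0 0 <> 0.
  apply: contrapT => noz; case/eqP: v_neq0.
  have [||a0 w0] := ann alpha w.
  - by have := psiM ord0; rewrite cons_family0.
  - by move=> z Sz; apply: contrapT => ?; apply: noz; exists z.
  rewrite -[v]hsubmxK -[rsubmx v]trmxK -/w w0 trmx0.
  rewrite (_ : lsubmx v = 0) ?row_mx0 //.
  by apply/rowP => j; rewrite !mxE ord1.
exists (cons_family z p); split; first exact: cons_family_ind.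
apply: (@affinely_independent_cons _ _ _ (fun z => (g z *m w) 0 0) alpha) => //.
  by move=> a x y /=; rewrite linearP mulmxDl -scalemxAl !mxE.
by move=> i; have := psiM (lift ord0 i); rewrite cons_familyS.
Qed.

Hypothesis g_inj : injective g.

(** More than 1 + n homogenized points are linearly dependent. The leading coordinate of the
    dependence says that its coefficients sum to 0; the others give the relation in [E], as [g] is
    injective. *)
Lemma affinely_independent_card (m : nat) (p : 'I_m -> E) :
  affinely_independent p -> (m <= n.+1)%N.
Proof.
move=> p_indep; rewrite leqNgt; apply/negP => lt_nm.
pose M : 'M_(m, 1 + n) := \matrix_i homogenize (p i).
have : kermx M != 0.
  rewrite -mxrank_eq0 mxrank_ker subn_eq0 -ltnNge.
  by rewrite (leq_ltn_trans (rank_leq_col M)).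
case/rowV0Pn => v /sub_kermxP vM /eqP; apply.
have vMj j : \sum_i v 0 i * homogenize (p i) 0 j = 0.
  have := congr1 (fun A : 'rV_(1 + n) => A 0 j) vM; rewrite !mxE => vMj.
  by apply: etrans vMj; apply: eq_bigr => i _; rewrite [M i j]mxE.
apply/rowP => i; rewrite mxE; apply: (p_indep (fun i => v 0 i)).
  apply: etrans (vMj (lshift n ord0)); apply: eq_bigr => j _.
  by rewrite row_mxEl mxE mulr1.
apply: g_inj; rewrite linear0 linear_sum; apply/rowP => j.
rewrite summxE mxE; apply: etrans (vMj (rshift 1 j)); apply: eq_bigr => l _.
by rewrite row_mxEr linearZ mxE.
Qed.

(** [indep_points] yields n independent points of the face, and [z0], having nonzero slack, extends
    any independent family of the face. With the bound n + 1 this fixes both dimensions: n - 1 for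
    the face and n for [C]. *)
Lemma facet_criterion C (f1 f2 : E -> R) (z0 : E) :
  (0 < n)%N -> scalar (fun z => f2 z - f1 z) -> valid_ineq C f1 f2 ->
  C z0 -> f1 z0 <> f2 z0 ->
  (forall (alpha : R) (w : 'cV[R]_n), alpha + (g z0 *m w) 0 0 = 0 ->
     (forall z, C z -> f1 z = f2 z -> alpha + (g z *m w) 0 0 = 0) ->
     alpha = 0 /\ w = 0) ->
  facet_defining C f1 f2.
Proof.
move=> n_gt0 slackS valid Cz0 z0_off ann; split => //.
have cons_z0 m (p : 'I_m -> E) : (forall i, (C `&` [set z | f1 z = f2 z]) (p i)) ->
    affinely_independent p -> affinely_independent (cons_family z0 p).
  move=> Fp p_indep.
  apply: (affinely_independent_cons (alpha := 0) slackS) => //.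
    by move=> i; have [_ /= ->] := Fp i; rewrite subrr addr0.
  by rewrite add0r => /eqP; rewrite subr_eq0 => /eqP/esym.
have [p [Fp p_indep]] : exists p : 'I_n.-1.+1 -> E,
    (forall i, (C `&` [set z | f1 z = f2 z]) (p i)) /\ affinely_independent p.
  apply: (indep_points (z0 := z0)); last by rewrite prednK.
  by move=> alpha w az0 aF; apply: ann => // z Cz fz; apply: aF.
exists n.-1; split; split.
- by exists p.
- move=> m q Fq q_indep; rewrite prednK // -ltnS.
  exact: affinely_independent_card (cons_z0 _ _ Fq q_indep).
- exists (cons_family z0 p); split; last exact: cons_z0.
  by apply: cons_family_ind => // i; have [] := Fp i.
- by move=> m q _ /affinely_independent_card; rewrite prednK.
Qed.

End Coordinates.
End Facets.

(** * Validity of the inequality on [P] *)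

Section Validity.
Variables (R : realType) (T L l : nat) (Cl Cu Vb V : R) (z : Defs.point R T).
Hypotheses (L_gt0 : (0 < L)%N) (l_gt0 : (0 < l)%N) (LT : (L + 1 <= T)%N).
Hypotheses (Cl_Vb : Cl <= Vb) (Vb_Cu : Vb <= Cu) (V_gt0 : 0 < V).
Hypothesis Pz : P L l Cl Cu Vb V z.

Lemma uc_ge0 i : (2 <= i <= T)%N -> 0 <= uc z i.
Proof. by case: Pz => _ [_ [u01 _]] /u01[]->. Qed.

Lemma uc_sum_ge0 m n : (2 <= m)%N -> (n <= T.+1)%N ->
  0 <= \sum_(m <= i < n) uc z i.
Proof.
move=> m2 nT; rewrite big_seq sumr_ge0 // => i; rewrite mem_index_iota => i_mn.
by apply: uc_ge0; lia.
Qed.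

Lemma yc_increase a b : (1 <= a <= b)%N -> (b <= T)%N ->
  yc z b - yc z a <= \sum_(a.+1 <= i < b.+1) uc z i.
Proof.
case: Pz => _ [_ [_ [_ [_ [yu _]]]]] /andP[a1].
elim: b => [|b IHb]; first by rewrite leqn0 => /eqP a0; rewrite a0 in a1.
rewrite leq_eqVlt => /orP[/eqP<- _|lt_ab bT].
  by rewrite big_geq // subrr.
rewrite big_nat_recr //=; have := IHb lt_ab (ltnW bT).
by by have := yu b.+1 ltac:(lia); rewrite subn1 /=; lra.
Qed.

(** For j > L this is part of the minimum up constraint at j. For j <= L there is no constraint at
    j; the one at L + 1 is combined with the increase of y from j to L + 1. *)
Lemma uc_window m j : (2 <= m)%N -> (j < m + L)%N -> (1 <= j <= T)%N ->
  \sum_(m <= i < j.+1) uc z i <= yc z j.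
Proof.
move=> m2 jmL /andP[j1 jT]; have [_ [_ [_ [up _]]]] := Pz.
have [Lj|jL] := leqP L.+1 j.
  apply: le_trans (up j _); last by lia.
  have [jm|mj] := leqP j.+1 m.
    by rewrite big_geq // uc_sum_ge0 //; lia.
  rewrite [leRHS](big_cat_nat (n := m)) /=; [|lia|lia].
  by rewrite lerDr uc_sum_ge0; lia.
have := up L.+1; rewrite addn1 leqnn -addn1 LT => /(_ isT).
rewrite (_ : L + 1 - L + 1 = 2)%N; last by lia.
rewrite addn1 (big_cat_nat (n := j.+1)) //=; last by lia.
have := @yc_increase j L.+1; rewrite j1 => /(_ (ltnW jL)); rewrite -addn1 => /(_ LT).
rewrite addn1.
have [jm|mj] := leqP j.+1 m.
  rewrite [in X in _ -> _ -> X]big_geq //.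
  by have := @uc_sum_ge0 2 j.+1 isT jT; lra.
rewrite [X in _ -> X + _ <= _ -> _](big_cat_nat (n := m)) //=; last by lia.
have : 0 <= \sum_(2 <= i < m) uc z i.
  by apply: uc_sum_ge0; lia.
lra.
Qed.

Lemma uc_le_yc i j : (2 <= i <= j)%N -> (j < i + L)%N -> (j <= T)%N ->
  uc z i <= yc z j.
Proof.
move=> /andP[i2 ij] jL jT.
apply: le_trans (@uc_window i j i2 jL _); last by lia.
by rewrite big_ltn ?ltnS // lerDl uc_sum_ge0 //; lia.
Qed.

Lemma yc_le1 j : (1 <= j <= T)%N -> yc z j <= 1.
Proof. by case: Pz => _ [y01 _] /y01[]->. Qed.

(** The minimum down constraint at i + l gives this if i + l <= T; otherwise the one at T does,
    combined with the increase of y from T - l to i. *)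
Lemma uc_down i : (l + 1 <= T)%N -> (1 <= i)%N -> (i < T)%N -> uc z i.+1 <= 1 - yc z i.
Proof.
move=> lT i1 iT; have [_ [_ [_ [_ [dn _]]]]] := Pz.
have [ilT|Til] := leqP (i + l) T.
  have := dn (i + l)%N ltac:(lia); rewrite addnK; apply: le_trans.
  rewrite addn1 big_ltn ?lerDl; last by lia.
  by apply: uc_sum_ge0; lia.
have := dn T; rewrite lT leqnn => /(_ isT).
rewrite addn1 (big_cat_nat (n := i.+1)) //=; try lia.
rewrite [X in _ + X](big_cat_nat (n := i.+2)) //= big_nat1.
have := @yc_increase (T - l) i; have := @uc_sum_ge0 i.+2 T.+1 isT (leqnn _).
move=> h1 /(_ _ _); rewrite (ltnW iT) => /(_ _ isT) h2 h3.
have {}h2 := h2 ltac:(lia); lra.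
Qed.

(** By [uc_down] the unit is off in period i - 1, so its output in i is at most Vb; the minimum up
    time keeps it on, and each later period adds at most V. *)
Lemma ramp_up i t : (l + 1 <= T)%N -> (2 <= i <= t)%N -> (t < i + L)%N -> (t <= T)%N ->
  uc z i = 1 -> xc z t <= Vb + (t%:R - i%:R) * V.
Proof.
move=> lT /andP[i2]; have [_ [y01 [_ [_ [_ [_ [bnd [up _]]]]]]]] := Pz.
elim: t => [|t IHt]; first by lia.
rewrite leq_eqVlt => /orP[/eqP <- _ iT ui|it tL tT ui].
  have [i1 i1T iS] : [/\ (1 <= i - 1)%N, (i - 1 < T)%N & (i - 1).+1 = i] by split; lia.
  have i1r : (1 <= i - 1 <= T)%N by rewrite i1 ltnW.
  have := uc_down lT i1 i1T; rewrite iS ui => yi.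
  have /andP[_ xi] := bnd _ i1r.
  have := up i; rewrite i2 iT => /(_ isT).
  by case: (y01 _ i1r) => e; rewrite e in yi xi *; lra.
have := IHt it (ltnW tL) (ltnW tT) ui.
have t2 : (2 <= t.+1 <= T)%N by lia.
have t1 : (1 <= t <= T)%N by lia.
have := up _ t2; rewrite subn1 /=.
have := @uc_le_yc i t; rewrite i2 /= => /(_ it (ltnW tL) (ltnW tT)).
have := yc_le1 t1; rewrite ui => h1 h2.
have -> : yc z t = 1 by lra.
rewrite -natr1; lra.
Qed.

Lemma sum_window_shift k t (F : nat -> R) : (k <= t)%N ->
  \sum_(1 <= s < k) F (t - s + 1)%N = \sum_(t - k + 2 <= i < t.+1) F i.
Proof.
elim: k => [|k IHk] kt; first by rewrite !big_geq //; lia.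
case: k IHk kt => [|k] IHk kt; first by rewrite !big_geq //; lia.
rewrite big_nat_recr //= IHk 1?ltnW // addrC [RHS]big_ltn; last by lia.
congr (F _ + bigop.body _ (index_iota _ _) _); lia.
Qed.

Lemma P_ineq k t : (l + 1 <= T)%N -> (1 <= k <= L)%N -> (k <= t <= T - 1)%N ->
  xc z t <= ineq_rhs Cu Vb V k t z.
Proof.
move=> lT /andP[k1 kL] /andP[kt tT]; rewrite /ineq_rhs addn1.
have [t1 t1T] : (1 <= t)%N /\ (t < T)%N by split; lia.
have [tr t1r t2r] : [/\ 1 <= t <= T, 1 <= t.+1 <= T & 2 <= t.+1 <= T]%N by split; lia.
have [y01 u01 bnd dn] : [/\ forall j, (1 <= j <= T)%N -> yc z j = 0 \/ yc z j = 1,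
    forall s, (1 <= s < k)%N -> uc z (t - s + 1) = 0 \/ uc z (t - s + 1) = 1,
    forall j, (1 <= j <= T)%N -> Cl * yc z j <= xc z j <= Cu * yc z j &
    xc z t - xc z t.+1 <= V * yc z t.+1 + Vb * (1 - yc z t.+1)].
  case: Pz => _ [y01 [u01 [_ [_ [_ [bnd [_ dn]]]]]]]; split => //.
    by move=> s sk; apply: u01; lia.
  by have := dn _ t2r; rewrite subn1.
have ut1 : uc z t.+1 <= yc z t.+1 by apply: uc_le_yc; lia.
(* If the unit is off in t or t + 1, the minimum up time excludes every start-up in the window,
   since k <= L. *)
have window0 j : (t <= j <= t.+1)%N -> yc z j = 0 ->
    \sum_(1 <= s < k) (Cu - Vb - (s%:R - 1) * V) * uc z (t - s + 1) = 0.
  move=> tj yj; rewrite big_nat big1 // => s sk.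
  have : uc z (t - s + 1) <= yc z j by apply: uc_le_yc; lia.
  by rewrite yj; case: (u01 s sk) => ->; rewrite ?mulr0 // ler10.
have /andP[_ xt] := bnd t tr.
have [yt|yt] := y01 t tr; rewrite yt in xt *.
  rewrite (window0 t) ?leqnn ?leqnSn //.
  have := mulr_ge0 (_ : 0 <= Cu - Vb) (_ : 0 <= yc z t.+1 - uc z t.+1).
  by rewrite !subr_ge0 => /(_ Vb_Cu ut1); lra.
have := uc_down lT t1 t1T; rewrite yt => u_le0.
have := uc_ge0 t2r => u_ge0.
have -> : uc z t.+1 = 0 by lra.
(* On in t and off in t + 1: the shut-down ramp gives x_t <= Vb. *)
have [yt1|yt1] := y01 _ t1r; rewrite yt1 in dn *.
  rewrite (window0 t.+1) ?leqnn ?leqnSn //.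
  by have := bnd _ t1r; rewrite yt1 => /andP[_]; lra.
suff: \sum_(1 <= s < k) (Cu - Vb - (s%:R - 1) * V) * uc z (t - s + 1) <=
    Cu - xc z t by lra.
(* By [ramp_up], the coefficient of a start-up that occurs is at most Cu - x_t, and the window holds
   at most one start-up. *)
apply: (@le_trans _ _ ((Cu - xc z t) * \sum_(1 <= s < k) uc z (t - s + 1))).
  rewrite mulr_sumr !big_nat; apply: ler_sum => s sk.
  have [us|us] := u01 s sk; rewrite us ?mulr0 // !mulr1.
  have [s1 s2 st] : [/\ 2 <= t - s + 1 <= t, t < t - s + 1 + L & s <= t]%N.
    by split; lia.
  have := ramp_up lT s1 s2 (ltnW t1T) us.
  by rewrite natrD natrB //; lra.
rewrite (@sum_window_shift k t (uc z)) // -[leRHS]mulr1 ler_wpM2l //; first lra.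
by rewrite -yt; apply: uc_window; lia.
Qed.

End Validity.

(** * Test points with a single run *)

Section Blocks.
Variables (R : realType) (T : nat).

Lemma entry_ord n (v : 'rV[R]_n) (i : 'I_n) : entry v i = v ord0 i.
Proof. by rewrite /entry valK. Qed.

Lemma entry_row n (F : 'I_n -> R) (i : nat) (lt_in : (i < n)%N) :
  entry (\row_j F j) i = F (Ordinal lt_in).
Proof. by rewrite -[i]/(val (Ordinal lt_in)) entry_ord mxE. Qed.

Lemma sum_nat_delta (F : nat -> R) (m n j : nat) :
  \sum_(m <= i < n) F i * (j == i)%:R = if (m <= j < n)%N then F j else 0.
Proof.
rewrite -(@big_nat1_eq _ _ +%R) [RHS]big_mkcond; apply: eq_bigr => i _.
by rewrite eq_sym; case: eqP => _; rewrite ?mulr1 ?mulr0.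
Qed.

(* One run of the unit over the periods s, .., e; a run with s = 1 is already
   under way at the start and records no start-up. *)
Definition block (s e : nat) (w : nat -> R) : Defs.point R T :=
  (\row_i (if (s <= i.+1 <= e)%N then w i.+1 else 0),
   \row_i (s <= i.+1 <= e)%N%:R, \row_i (s == i.+2)%:R).

Lemma xc_block s e w i : (1 <= i <= T)%N ->
  xc (block s e w) i = if (s <= i <= e)%N then w i else 0.
Proof.
case: i => // i iT; have lt_iT : (i.+1 - 1 < T)%N by lia.
by rewrite /xc /block /= (entry_row _ lt_iT) /= subn1.
Qed.

Lemma yc_block s e w i : (1 <= i <= T)%N ->
  yc (block s e w) i = (s <= i <= e)%N%:R.
Proof.
case: i => // i iT; have lt_iT : (i.+1 - 1 < T)%N by lia.
by rewrite /yc /block /= (entry_row _ lt_iT) /= subn1.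
Qed.

Lemma uc_block s e w i : (2 <= i <= T)%N -> uc (block s e w) i = (s == i)%:R.
Proof.
case: i => [|[|i]] // iT; have lt_iT : (i.+2 - 2 < T.-1)%N by lia.
by rewrite /uc /block /= (entry_row _ lt_iT) /= subn2.
Qed.

Lemma sum_uc_block s e w m n : (2 <= m)%N -> (n <= T.+1)%N ->
  \sum_(m <= i < n) uc (block s e w) i = (m <= s < n)%N%:R.
Proof.
move=> m2 nT; transitivity (\sum_(m <= i < n) 1 * (s == i)%:R : R).
  by apply: eq_big_nat => i i_mn; rewrite uc_block ?mul1r //; lia.
by rewrite sum_nat_delta; case: ifP.
Qed.

Variables (Cu Vb V : R).

(** Only the window term with index t - s + 1 can survive. The formula also covers s = 1, where no
    start-up is recorded: k <= t then makes the condition of the last term false. *)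
Lemma ineq_rhs_block s e w k t :
  (1 <= s)%N -> (k <= t)%N -> (1 <= t < T)%N -> (s <= t)%N ->
  ineq_rhs Cu Vb V k t (block s e w) =
  Vb * (t <= e)%N%:R + (Cu - Vb) * (t < e)%N%:R -
  (if (t.+1 < k + s)%N then Cu - Vb - (t - s)%N%:R * V else 0).
Proof.
move=> s1 kt tT st; rewrite /ineq_rhs addn1 !yc_block ?uc_block; [|lia..].
rewrite (_ : (s == t.+1) = false) ?subr0; last by lia.
congr (Vb * _%:R + _ * _%:R - _); [lia..|].
transitivity (\sum_(1 <= j < k)
    (Cu - Vb - (j%:R - 1) * V) * ((t - s).+1 == j)%:R).
  apply: eq_big_nat => j jk; rewrite uc_block; last by lia.
  by congr (_ * _%:R); lia.
rewrite sum_nat_delta -natr1 addrK.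
by rewrite (_ : (1 <= (t - s).+1 < k)%N = (t.+1 < k + s)%N) //; lia.
Qed.

(** If s = t + 1, the start-up cancels y_(t+1); all other terms are 0. *)
Lemma ineq_rhs_block_late s e w k t :
  (t < s)%N -> (s <= e)%N -> (k <= t)%N -> (1 <= t < T)%N ->
  ineq_rhs Cu Vb V k t (block s e w) = 0.
Proof.
move=> ts se kt tT; rewrite /ineq_rhs addn1 !yc_block ?uc_block; [|lia..].
rewrite (_ : (s <= t <= e)%N = false) ?mulr0 ?add0r; last by lia.
rewrite (_ : (s <= t.+1 <= e)%N = (s == t.+1)) ?subrr ?mulr0 ?add0r; last by lia.
rewrite big_nat big1 ?oppr0 // => j jk; rewrite uc_block; last by lia.
by rewrite (_ : (s == _) = false) ?mulr0 //; lia.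
Qed.

Variables (L l : nat) (Cl : R).
Hypotheses (Cl_ge0 : 0 <= Cl) (Cl_Vb : Cl <= Vb) (Vb_Cu : Vb <= Cu) (V_gt0 : 0 < V).

(** The minimum up time binds only a run that both starts and stops inside the horizon, hence the
    three alternatives. Inside the run the ramps are those of [w]; at its ends they require Vb. *)
Lemma block_P s e w :
  (1 <= s)%N -> (e <= T)%N -> [|| s == 1%N, (s + L <= e.+1)%N | e == T] ->
  (forall i, Cl <= w i <= Cu) -> (forall i, `|w i.+1 - w i| <= V) ->
  ((1 < s)%N -> w s <= Vb) -> ((e < T)%N -> w e <= Vb) ->
  P L l Cl Cu Vb V (block s e w).
Proof.
move=> s1 eT up w_itv w_ramp w_start w_stop.
have Cu_ge0 : 0 <= Cu := le_trans Cl_ge0 (le_trans Cl_Vb Vb_Cu).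
have Vb_ge0 : 0 <= Vb := le_trans Cl_ge0 Cl_Vb.
have V_ge0 := ltW V_gt0.
have lerNl0 i : - w i <= 0.
  by rewrite oppr_le0 (le_trans Cl_ge0) //; have /andP[] := w_itv i.
pose simp := (mulr1, mulr0, subrr, subr0, addr0, add0r, sub0r).
do !split.
- move=> t tT; rewrite xc_block //; case: ifP => // _.
  by have /andP[+ _] := w_itv t; apply: le_trans.
- by move=> t tT; rewrite yc_block //; case: (_ <= _ <= _)%N; [right|left].
- by move=> t tT; rewrite uc_block //; case: (_ == _); [right|left].
- move=> t tT; rewrite sum_uc_block ?yc_block ?ler_nat; clear -s1 eT up tT; lia.
- move=> t tT; rewrite sum_uc_block ?yc_block ?lerBrDr -?natrD ?lern1; clear -s1 eT up tT; lia.
- move=> t tT; rewrite !yc_block ?uc_block ?lerBlDr ?add0r ?lerBlDr -?natrD ?ler_nat; clear -s1 eT up tT; lia.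
- move=> t tT; rewrite xc_block ?yc_block //.
  by case: ifP => _; rewrite ?mulr1 ?mulr0 ?lexx.
- move=> t tT; rewrite !xc_block ?yc_block; [|clear -tT; lia..].
  have := w_ramp t.-1; rewrite (_ : t.-1.+1 = t) ?subn1; last by clear -tT; lia.
  rewrite ler_norml => /andP[_ w_up].
  case: ifP => on_t; case: ifP => on_p; rewrite /= !simp //.
    have [-> s2] : t = s /\ (1 < s)%N by clear -s1 tT on_t on_p; lia.
    exact: w_start.
  exact: (le_trans (lerNl0 _)).
- move=> t tT; rewrite !xc_block ?yc_block; [|clear -tT; lia..].
  have := w_ramp t.-1; rewrite (_ : t.-1.+1 = t) ?subn1; last by clear -tT; lia.
  rewrite ler_norml lerNl opprB => /andP[w_dn _].
  case: ifP => on_t; case: ifP => on_p; rewrite /= !simp //.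
    have [-> e1] : t.-1 = e /\ (e < T)%N by clear -eT tT on_t on_p; lia.
    exact: w_stop.
  exact: (le_trans (lerNl0 _)).
Qed.

End Blocks.

(** * An affine function vanishing on the face and at one point off it is zero *)

Section Annihilator.
Variables (R : realType) (T L l : nat) (Cl Cu Vb V : R) (k t : nat).
Hypotheses (Cl_ge0 : 0 <= Cl) (Cl_Vb : Cl <= Vb) (Vb_Cu : Vb <= Cu) (V_gt0 : 0 < V).
Hypotheses (Cl_Cu : Cl < Cu) (kt : (1 <= k <= t)%N) (tT : (t < T)%N).
Hypotheses (k_le_L : (k <= L)%N) (L_gt1 : (1 < L)%N -> (1 < k)%N).
(** This and [ramp_large] are how the maximal choice of k enters: j periods after a start-up, the
    ramp Vb + j V is at most Cu within the window, and at least Cu beyond it as long as j + 1 <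
    L. *)
Hypothesis ramp_small : forall j, (j.+1 < k)%N -> j%:R * V <= Cu - Vb.
Hypothesis ramp_large : forall j, (k <= j.+1 < L)%N -> Cu - Vb <= j%:R * V.
Hypothesis L_small : (L <= 3)%N \/ t = (T - 1)%N.
Variables (alpha : R) (A B C : nat -> R).

Definition affine_value (z : Defs.point R T) : R :=
  alpha + \sum_(1 <= i < T.+1) A i * xc z i + \sum_(1 <= i < T.+1) B i * yc z i
  + \sum_(2 <= i < T.+1) C i * uc z i.

Hypothesis vanish : forall z, P L l Cl Cu Vb V z ->
  xc z t = ineq_rhs Cu Vb V k t z -> affine_value z = 0.

Lemma affine_value_block s e w : (1 <= s)%N -> (e <= T)%N ->
  affine_value (block T s e w) =
  alpha + \sum_(1 <= i < T.+1) A i * (if (s <= i <= e)%N then w i else 0)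
  + \sum_(s <= i < e.+1) B i + (if (2 <= s < T.+1)%N then C s else 0).
Proof.
move=> s1 eT; rewrite /affine_value -(sum_nat_delta C).
congr (alpha + _ + _ + _).
- by apply: eq_big_nat => i iT; rewrite xc_block.
- rewrite [RHS](big_nat_widenl _ 1) // [RHS](big_nat_widen _ _ T.+1) // [RHS]big_mkcond /=.
  apply: eq_big_nat => i iT; rewrite yc_block // -ltnS.
  by case: ifP; rewrite ?mulr1 ?mulr0.
- by apply: eq_big_nat => i iT; rewrite uc_block.
Qed.

Lemma Cu_itv : Cl <= Cu <= Cu. Proof. by rewrite lexx ltW. Qed.
Lemma Vb_itv : Cl <= Vb <= Cu. Proof. by rewrite Cl_Vb. Qed.
Let V_ge0 : 0 <= V := ltW V_gt0.
Let t_itv : (1 <= t <= T)%N. Proof. by clear -kt tT; lia. Qed.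
Let t_lt : (1 <= t < T)%N. Proof. by clear -kt tT; lia. Qed.
Let k_le_t : (k <= t)%N. Proof. by case/andP: kt. Qed.
Let no_ramp : (t.+1 < k + 1)%N = false. Proof. by clear -kt; lia. Qed.

Lemma const_ramp (c : R) (i : nat) : `|(fun _ : nat => c) i.+1 - (fun=> c) i| <= V.
Proof. by rewrite subrr normr0. Qed.

Lemma alpha_eq0 : alpha = 0.
Proof.
(* The run from 1 to 0 is empty: this is the zero point, which lies on the face. *)
have := vanish (z := block T 1 0 (fun=> Vb)).
rewrite affine_value_block // [\sum_(1 <= i < 1) _]big_geq // big_nat big1.
  rewrite !addr0; apply.
    by apply: block_P => // i; [exact: Vb_itv|exact: const_ramp].
  rewrite xc_block // ineq_rhs_block //; last by clear -t_itv; lia.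
  rewrite no_ramp; have [-> ->] : (t <= 0)%N = false /\ (t < 0)%N = false.
    by clear -t_itv; lia.
  by rewrite andbF /= !mulr0 subr0 addr0.
move=> i iT; have -> : (1 <= i <= 0)%N = false by clear -iT; lia.
by rewrite mulr0.
Qed.

Let eps : R := Num.min V (Cu - Cl).

Let eps_gt0 : 0 < eps. Proof. by rewrite lt_min V_gt0 subr_gt0. Qed.

(** The drop respects both the ramp V and the lower bound Cl, and it is positive because Cl < Cu. *)
Definition dip (i j : nat) : R := if j == i then Cu - Num.min V (Cu - Cl) else Cu.

Lemma dip_P i : P L l Cl Cu Vb V (block T 1 T (dip i)).
Proof.
have [eV eC e0] : [/\ eps <= V, eps <= Cu - Cl & 0 <= eps].
  by rewrite (ltW eps_gt0) !ge_min !lexx orbT.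
apply: block_P; rewrite ?eqxx ?orbT ?ltnn // => j; rewrite /dip -/eps.
  by case: ifP => _; apply/andP; split; lra.
by do 2 case: ifP => _; rewrite ler_norml; apply/andP; split; lra.
Qed.

Lemma ineq_rhs_on w : ineq_rhs Cu Vb V k t (block T 1 T w) = Cu.
Proof.
rewrite ineq_rhs_block ?no_ramp //; last by case/andP: t_itv.
by rewrite tT (ltnW tT) /=; lra.
Qed.

Lemma dip_off_face :
  xc (block T 1 T (dip t)) t <> ineq_rhs Cu Vb V k t (block T 1 T (dip t)).
Proof.
rewrite ineq_rhs_on xc_block // t_itv /dip eqxx -/eps.
by have := eps_gt0; lra.
Qed.

(** For i different from t the dip stays on the face; for i = t it is the point off the face, where
    the value 0 is assumed. *)
Lemma A_eq0 i : affine_value (block T 1 T (dip t)) = 0 -> (1 <= i <= T)%N -> A i = 0.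
Proof.
move=> dip_t iT.
have dip_i : affine_value (block T 1 T (dip i)) = 0.
  have [->//|it] := eqVneq i t; apply: vanish; first exact: dip_P.
  by rewrite ineq_rhs_on xc_block // t_itv /dip eq_sym (negbTE it).
have on0 : affine_value (block T 1 T (fun=> Cu)) = 0.
  apply: vanish; last by rewrite ineq_rhs_on xc_block // t_itv.
  by apply: block_P; rewrite ?eqxx ?orbT ?ltnn // => j;
    [exact: Cu_itv|exact: const_ramp].
have : \sum_(1 <= j < T.+1) A j * eps * (i == j)%:R = 0.
  move: dip_i on0; rewrite !affine_value_block // => dip_i on0.
  transitivity (\sum_(1 <= j < T.+1) A j * (if (1 <= j <= T)%N then Cu else 0) -
      \sum_(1 <= j < T.+1) A j * (if (1 <= j <= T)%N then dip i j else 0)); last lra.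
  rewrite -sumrB; apply: eq_big_nat => j jT; rewrite jT /dip -/eps eq_sym.
  by case: eqP => _; rewrite /=; ring.
rewrite (sum_nat_delta (fun j => A j * eps)) ltnS iT => /eqP.
by rewrite mulf_eq0 (gt_eqF eps_gt0) orbF => /eqP.
Qed.

Hypothesis A0 : forall i, (1 <= i <= T)%N -> A i = 0.

(** Since [alpha] and [A] vanish, the profile [w] only serves to place the run on the face. *)
Lemma tight_sum s e w :
  (1 <= s)%N -> (e <= T)%N -> [|| s == 1%N, (s + L <= e.+1)%N | e == T] ->
  (forall i, Cl <= w i <= Cu) -> (forall i, `|w i.+1 - w i| <= V) ->
  ((1 < s)%N -> w s <= Vb) -> ((e < T)%N -> w e <= Vb) ->
  (if (s <= t <= e)%N then w t else 0) = ineq_rhs Cu Vb V k t (block T s e w) ->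
  \sum_(s <= i < e.+1) B i + (if (2 <= s < T.+1)%N then C s else 0) = 0.
Proof.
move=> s1 eT up w_itv w_ramp w_start w_stop tight.
have := vanish (z := block T s e w); rewrite xc_block // affine_value_block //.
rewrite alpha_eq0 big_nat big1 ?add0r => [|i iT]; last by rewrite A0 ?mul0r.
by apply => //; apply: block_P.
Qed.

Lemma sum_init e : (e <= t)%N -> \sum_(1 <= i < e.+1) B i = 0.
Proof.
move=> et; have eT : (e <= T)%N by clear -et tT; lia.
have := @tight_sum 1 e (fun=> Vb); rewrite addr0; apply => //.
- by move=> i; exact: Vb_itv.
- by move=> i; exact: const_ramp.
- rewrite ineq_rhs_block // ?no_ramp; last by case/andP: t_itv.
  rewrite (ltnNge t) et; case/andP: t_itv => -> _.
  by case: (t <= e)%N; rewrite /= ?mulr1 ?mulr0 subr0 addr0.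
Qed.

Lemma sum_all : \sum_(1 <= i < T.+1) B i = 0.
Proof.
have := @tight_sum 1 T (fun=> Cu); rewrite addr0; apply => //.
- by move=> i; exact: Cu_itv.
- by move=> i; exact: const_ramp.
- by rewrite ltnn.
- by rewrite ineq_rhs_on t_itv.
Qed.

Lemma sum_late s e : (t < s <= e)%N -> (e <= T)%N ->
  (s + L <= e.+1)%N || (e == T) -> \sum_(s <= i < e.+1) B i + C s = 0.
Proof.
move=> /andP[ts se] eT up; have s1 : (1 <= s)%N := leq_ltn_trans (leq0n _) ts.
have sT : (2 <= s < T.+1)%N by clear -t_itv ts se eT; lia.
have := @tight_sum s e (fun=> Vb); rewrite sT; apply => //.
- by rewrite up orbT.
- by move=> i; exact: Vb_itv.
- by move=> i; exact: const_ramp.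
- by rewrite ineq_rhs_block_late // leqNgt ts.
Qed.

(** As k > 1, a start-up in t lowers the right-hand side from Cu to Vb, so constant output Vb is
    tight. *)
Lemma sum_start e : (1 < k)%N -> (t < e <= T)%N -> (t + L <= e.+1)%N ->
  \sum_(t <= i < e.+1) B i + C t = 0.
Proof.
move=> k1 /andP[te eT] up; have [/andP[t1 _] t2T] : (1 <= t <= T)%N /\ (2 <= t < T.+1)%N.
  by clear -k1 kt tT; lia.
have := @tight_sum t e (fun=> Vb); rewrite t2T; apply => //.
- by rewrite up orbT.
- by move=> i; exact: Vb_itv.
- by move=> i; exact: const_ramp.
- rewrite ineq_rhs_block // subnn leqnn te (ltnW te) /=.
  by rewrite (_ : (t.+1 < k + t)%N); [lra|clear -k1; lia].
Qed.

(* Producing Vb in every period but t, the unit can stop right after t + 1. *)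
Lemma sum_peak e : (1 < k)%N -> L = 3%N -> (t < e <= T)%N ->
  \sum_(t.-1 <= i < e.+1) B i + (if (2 <= t.-1 < T.+1)%N then C t.-1 else 0) = 0.
Proof.
move=> k1 L3 /andP[te eT].
have [t1 tS t2] : [/\ (1 <= t.-1)%N, t.-1.+1 = t & (t.-1 <= t <= e)%N].
  by clear -k1 kt te; split; lia.
(* The largest output reachable from Vb in one step. It is tight: for k = 3 both sides are Vb + V,
   for k = 2 both are Cu. *)
pose h := Num.min Cu (Vb + V).
have [hC hV Vbh] : [/\ h <= Cu, h <= Vb + V & Vb <= h].
  by rewrite /h !ge_min !le_min !lexx orbT Vb_Cu lerDl.
apply: (@tight_sum t.-1 e (fun i => if i == t then h else Vb)) => //.
- by rewrite L3 (_ : (t.-1 + 3 <= e.+1)%N) ?orbT //; clear -tS te; lia.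
- by move=> i; case: ifP => _; [rewrite hC (le_trans Cl_Vb)|exact: Vb_itv].
- by move=> i; do 2 case: ifP => _; rewrite ler_norml; apply/andP; split; lra.
- by rewrite ifN // -{2}tS; clear; lia.
- by rewrite ifN // neq_ltn te orbT.
- rewrite eqxx t2 ineq_rhs_block ?leq_pred // te (ltnW te) /=.
  rewrite (_ : t - t.-1 = 1)%N; last by clear -tS; lia.
  case: ifP => [k3|/negbT k3].
    have := @ramp_small 1; rewrite mul1r => /(_ ltac:(clear -k3 tS; lia)) VD.
    by rewrite /h min_r; lra.
  have := @ramp_large 1; rewrite mul1r => /(_ ltac:(clear -k3 tS L3; lia)) VD.
  by rewrite /h min_l; lra.
Qed.

(** The run stops in t, and its length, at least L >= k, puts the start-up before the window:
    constant output Vb is tight. *)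
Lemma sum_short s : (2 <= s)%N -> (s + L <= t.+1)%N ->
  \sum_(s <= i < t.+1) B i + C s = 0.
Proof.
move=> s2 up; have [sT s1 st] : [/\ (2 <= s < T.+1)%N, (1 <= s)%N & (s <= t)%N].
  by clear -s2 up tT k_le_L kt; split; lia.
have := @tight_sum s t (fun=> Vb); rewrite sT; apply => //.
- exact: ltnW.
- by rewrite up orbT.
- by move=> i; exact: Vb_itv.
- by move=> i; exact: const_ramp.
- rewrite ineq_rhs_block // st leqnn ltnn /=.
  by rewrite (_ : (_ < k + s)%N = false); [lra|clear -up k_le_L; lia].
Qed.

Lemma sum_ramp s : (2 <= s <= t)%N -> (t.+1 < s + L)%N ->
  \sum_(s <= i < T.+1) B i + C s = 0.
Proof.
move=> /andP[s2 st] tsL; have [sT s1] : (2 <= s < T.+1)%N /\ (1 <= s)%N.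
  by clear -s2 st tT; lia.
(* The fastest ramp from Vb, capped at Cu; truncated subtraction makes it constant before s. *)
pose w (i : nat) : R := Num.min Cu (Vb + (i - s)%N%:R * V).
have := @tight_sum s T w; rewrite sT; apply => //.
- by rewrite eqxx !orbT.
- move=> i; rewrite /w le_min ge_min lexx (ltW Cl_Cu) /= andbT.
  by rewrite (le_trans Cl_Vb) // lerDl mulr_ge0.
- move=> i; have [si|lt_is] := leqP s i; last first.
    by rewrite /w (_ : i.+1 - s = i - s)%N ?subrr ?normr0 //; clear -lt_is; lia.
  rewrite /w subSn // -natr1 mulrDl mul1r.
  have := V_ge0; move: (_%:R * V) => c V0; rewrite ler_norml.
  case: (leP Cu (Vb + (c + V))) => h1; case: (leP Cu (Vb + c)) => h2;
    apply/andP; split; lra.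
- by move=> _; rewrite /w subnn mul0r addr0 ge_min lexx orbT.
- by rewrite ltnn.
- rewrite ineq_rhs_block // st (ltnW tT) tT /= /w.
  (* For a start-up in the window the ramp is at most the cap in t; for an earlier one it is at
     least the cap. *)
  case: ifP => [tks|/negbT tks].
    have := @ramp_small (t - s) ltac:(clear -tks st; lia) => h.
    by rewrite min_r; lra.
  have := @ramp_large (t - s) ltac:(clear -tks tsL st; lia) => h.
  by rewrite min_l; lra.
Qed.

Lemma B_eq0_diff s e c : (s <= e)%N ->
  \sum_(s <= i < e) B i + c = 0 -> \sum_(s <= i < e.+1) B i + c = 0 -> B e = 0.
Proof. by move=> se; rewrite (big_nat_recr _ _ _ se) /=; lra. Qed.

Lemma B_eq0_init i : (1 <= i <= t)%N -> B i = 0.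
Proof.
case: i => // i /= it; apply: (@B_eq0_diff 1 i.+1 0) => //; rewrite addr0.
  by rewrite sum_init // ltnW.
exact: sum_init.
Qed.

(** The two runs start in t + 1 if the shorter one then has length at least L; otherwise in t or t -
    1, where it has length exactly L. For L <= 3 this covers every e, and for t = T - 1 there is no
    e. *)
Lemma B_eq0_late e : (t.+1 < e <= T)%N -> B e = 0.
Proof.
case: e => // e /andP[te eT]; have [L3|tT1] := L_small; last by clear -tT1 te eT; lia.
have [e_large|e_small] := leqP (t + L) e.
  by apply: (@B_eq0_diff t.+1 e.+1 (C t.+1));
    rewrite ?sum_late //; clear -te eT e_large; lia.
have L2 : (1 < L)%N by clear -e_small te; lia.
have k2 := L_gt1 L2.
have [eL|eL] := eqVneq (t + L)%N e.+1.
  by apply: (@B_eq0_diff t e.+1 (C t)); rewrite ?sum_start //; clear -te eT eL L2; lia.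
have L3' : L = 3%N by clear -te L3 L2 eL e_small; lia.
apply: (@B_eq0_diff t.-1 e.+1); first by clear -te; lia.
  by apply: sum_peak => //; clear -te eT; lia.
by apply: sum_peak => //; clear -te eT; lia.
Qed.

Lemma B_eq0 i : (1 <= i <= T)%N -> B i = 0.
Proof.
have B0 j : (1 <= j <= T)%N -> j != t.+1 -> B j = 0.
  move=> jT jt; have [j_le|j_gt] := leqP j t.
    by apply: B_eq0_init; clear -j_le jT; lia.
  by apply: B_eq0_late; clear -j_gt jT jt; lia.
move=> iT; have [->|] := eqVneq i t.+1; last exact: B0.
(* The all-on run isolates the one remaining coefficient. *)
have := sum_all; rewrite (_ : \sum_(1 <= i < T.+1) B i =
    \sum_(1 <= i < T.+1) B i * (t.+1 == i)%:R).
  by rewrite sum_nat_delta ifT // ltnS tT.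
apply: eq_big_nat => j jT; rewrite eq_sym.
by case: eqVneq => [_|jt]; rewrite ?mulr1 // mulr0 B0.
Qed.

(** With B = 0, one tight run starting in s suffices: a late one for s > t, one stopping in t if it
    can last L periods, and a ramping one in between. *)
Lemma C_eq0 s : (2 <= s <= T)%N -> C s = 0.
Proof.
move=> /andP[s2 sT].
have B_sum e : (e <= T)%N -> \sum_(s <= i < e.+1) B i + C s = 0 -> C s = 0.
  move=> eT; rewrite big_nat big1 ?add0r // => i ie.
  by apply: B_eq0; clear -ie eT s2; lia.
have [st|ts] := leqP s t; last by apply: (B_sum T) => //; rewrite sum_late ?eqxx ?orbT ?ts.
have [sL|tL] := leqP (s + L) t.+1.
  by apply: (B_sum t); [exact: ltnW|exact: sum_short].
by apply: (B_sum T) => //; rewrite sum_ramp // s2.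
Qed.

End Annihilator.

(** * Linear coordinates on the space of points *)

Section Coordinates.
Variables (R : realType) (T : nat).

Definition coords (z : Defs.point R T) : 'rV[R]_(T + (T + T.-1)) :=
  row_mx z.1.1 (row_mx z.1.2 z.2).

Fact coords_is_linear : linear coords.
Proof. by move=> a z z'; rewrite /coords !scale_row_mx !add_row_mx. Qed.

HB.instance Definition _ :=
  GRing.isLinear.Build R (Defs.point R T) 'rV[R]_(T + (T + T.-1)) _ coords coords_is_linear.

Lemma coords_inj : injective coords.
Proof. by move=> [[x y] u] [[x' y'] u'] /eq_row_mx[/= -> /eq_row_mx[-> ->]]. Qed.

Lemma sum_entry n (v : 'rV[R]_n) (w : 'cV[R]_n) :
  (v *m w) 0 0 = \sum_(0 <= i < n) entry w^T i * entry v i.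
Proof.
rewrite mxE big_mkord; apply: eq_bigr => i _.
by rewrite !entry_ord mxE mulrC.
Qed.

Lemma entry_eq0 n (w : 'cV[R]_n) :
  (forall i, (i < n)%N -> entry w^T i = 0) -> w = 0.
Proof.
move=> w0; apply/colP => i; have := w0 i (ltn_ord i).
by rewrite entry_ord !mxE.
Qed.

Lemma affine_coords (alpha : R) (wx wy : 'cV[R]_T) (wu : 'cV[R]_T.-1) z :
  alpha + (coords z *m col_mx wx (col_mx wy wu)) 0 0 =
  affine_value alpha (fun i => entry wx^T (i - 1)) (fun i => entry wy^T (i - 1))
    (fun i => entry wu^T (i - 2)) z.
Proof.
rewrite /affine_value !mul_row_col mxE [X in _ + (_ + X)]mxE !sum_entry !addrA.
rewrite !big_add1 /=; congr (_ + _ + _ + _); apply: eq_bigr => i _.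
- by rewrite /xc subn1.
- by rewrite /yc subn1.
- by rewrite /uc subn2.
Qed.

Lemma entryP n a (u v : 'rV[R]_n) i :
  entry (a *: u + v) i = a * entry u i + entry v i.
Proof. by rewrite /entry; case: insub => [j|] /=; rewrite ?mxE // mulr0 addr0. Qed.

(** The slack has no constant term, so [conv_hull_ge0] carries its nonnegativity from [P] to the
    hull. *)
Lemma slack_scalar (Cu Vb V : R) k t :
  scalar (fun z : Defs.point R T => ineq_rhs Cu Vb V k t z - xc z t).
Proof.
move=> a z z'; rewrite /ineq_rhs /xc /yc /uc /= !entryP.
under eq_bigr do rewrite entryP mulrDr mulrCA.
by rewrite big_split /= -mulr_sumr; ring.
Qed.

End Coordinates.

(** * Arithmetic of the largest window size [kmax] *)

Section MaximalWindow.
Variables (R : realType) (L : nat) (Cu Vb V : R).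
Hypotheses (Vb_Cu : Vb <= Cu) (V_gt0 : 0 < V).

Let D_ge0 : 0 <= (Cu - Vb) / V.
Proof. by rewrite divr_ge0 ?subr_ge0 // ltW. Qed.

Lemma kmax_le_L k : k%:Z <= kmax L Cu Vb V -> (k <= L)%N.
Proof. by rewrite /kmax le_min => /andP[]. Qed.

(** For Vb = Cu this leaves at most the window term s = 1, whose coefficient Cu - Vb is 0. *)
Lemma kmax_le2 k : Vb = Cu -> k%:Z <= kmax L Cu Vb V -> (k <= 2)%N.
Proof. by move=> ->; rewrite /kmax subrr mul0r floor0 le_min => /andP[]. Qed.

Lemma kmax_gt1 k : k%:Z = kmax L Cu Vb V -> (1 < L)%N -> (1 < k)%N.
Proof.
move=> kE L1; rewrite -ltz_nat kE /kmax lt_min ltz_nat L1 /=.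
have : 0 <= Num.floor ((Cu - Vb) / V) by rewrite floor_ge0.
by move: (Num.floor _) => f; clear; lia.
Qed.

Lemma kmax_ramp_small k j : k%:Z <= kmax L Cu Vb V -> (j.+1 < k)%N ->
  j%:R * V <= Cu - Vb.
Proof.
rewrite /kmax le_min => /andP[_ k_le] jk; rewrite -ler_pdivlMr //.
apply: le_trans (floor_le _); rewrite -[j%:R]/(j%:Z%:~R) ler_int.
by move: (Num.floor _) k_le => f; clear -jk; lia.
Qed.

(** As k < L, the minimum is the floor plus 2, so j is at least the floor plus 1. *)
Lemma kmax_ramp_large k j : k%:Z = kmax L Cu Vb V -> (k <= j.+1 < L)%N ->
  Cu - Vb <= j%:R * V.
Proof.
move=> kE /andP[kj jL]; rewrite -ler_pdivrMr //.
apply: le_trans (ltW (floorD1_gt _)) _; rewrite -[j%:R]/(j%:Z%:~R) ler_int.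
by move: kE; rewrite /kmax; move: (Num.floor _) => f; case: leP; clear -kj jL; lia.
Qed.

End MaximalWindow.

(** * Validity and the facet property on the convex hull *)

Theorem proposition4 (R : realType) (T L l : nat) (Cl Cu Vb V : R)
    (L_gt0 : (0 < L)%N) (l_gt0 : (0 < l)%N) (LT : (L + 1 <= T)%N)
    (Cl_ge0 : 0 <= Cl) (Cl_Vb : Cl <= Vb) (Vb_Cu : Vb <= Cu) (V_gt0 : 0 < V)
    (lT : (l + 1 <= T)%N \/ Vb = Cu)
    (k t : nat) (k_ge1 : (1 <= k)%N) (k_le : k%:Z <= kmax L Cu Vb V)
    (t_range : (k <= t <= T - 1)%N) :
  valid_ineq (conv_hull (P (T := T) L l Cl Cu Vb V))
    (fun z => xc z t) (ineq_rhs Cu Vb V k t) /\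
  (Cl < Cu ->
   ((L <= 3)%N /\ k%:Z = kmax L Cu Vb V) \/
   [/\ (4 <= L)%N, k%:Z = kmax L Cu Vb V & t = (T - 1)%N] ->
   facet_defining (conv_hull (P (T := T) L l Cl Cu Vb V))
     (fun z => xc z t) (ineq_rhs Cu Vb V k t)).
Proof.
have k_le_L := kmax_le_L k_le.
have [kt tT] : (1 <= k <= t)%N /\ (t < T)%N by clear -k_ge1 LT t_range; lia.
have valid : valid_ineq (conv_hull (P (T := T) L l Cl Cu Vb V))
    (fun z => xc z t) (ineq_rhs Cu Vb V k t).
  move=> z Cz; rewrite -subr_ge0; move: z Cz.
  apply: (conv_hull_ge0 (slack_scalar Cu Vb V k t)) => z Pz; rewrite subr_ge0.
  (* If T <= l, no down-time constraint prevents recording a start-up while the unit is on. In that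
     case Vb = Cu, and the inequality reads x_t <= Cu y_t. *)
  have [lT'|VbE] := lT.
    by apply: (P_ineq L_gt0 l_gt0 LT Cl_Vb Vb_Cu V_gt0 Pz lT' _ t_range); rewrite k_ge1.
  have k2 := kmax_le2 VbE k_le.
  have [_ [_ [_ [_ [_ [_ [bnd _]]]]]]] := Pz.
  have /andP[_ xt] := bnd t ltac:(clear -kt tT; lia).
  rewrite /ineq_rhs VbE subrr mul0r addr0 big_nat big1 ?subr0 // => s sk.
  by rewrite (_ : s = 1%N) ?subrr ?mul0r ?subr0 ?mul0r //; clear -sk k2; lia.
(* For Cl = Cu the inequality would be an equation on all of [P], hence no facet. *)
split => // Cl_Cu cases.
have [kE L_small] : k%:Z = kmax L Cu Vb V /\ ((L <= 3)%N \/ t = (T - 1)%N).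
  by case: cases => [[]|[]]; auto.
have L_gt1 := kmax_gt1 Vb_Cu V_gt0 kE.
have ramp_small j := kmax_ramp_small V_gt0 (j := j) k_le.
have ramp_large j := kmax_ramp_large V_gt0 (j := j) kE.
apply: (facet_criterion (@coords_inj R T) (z0 := block T 1 T (dip Cl Cu V t))) => //.
- by rewrite addn_gt0 (leq_ltn_trans (leq0n _) tT).
- exact: slack_scalar.
- by apply: conv_hull_sub; apply: dip_P.
- exact: dip_off_face.
move=> alpha w; rewrite -[w]vsubmxK -[dsubmx w]vsubmxK affine_coords.
set wx := usubmx w; set wy := usubmx _; set wu := dsubmx _ => dip0 vanish.
have {}vanish (z : Defs.point R T) : P L l Cl Cu Vb V z -> xc z t = ineq_rhs Cu Vb V k t z ->
    affine_value alpha (fun i => entry wx^T (i - 1)) (fun i => entry wy^T (i - 1))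
      (fun i => entry wu^T (i - 2)) z = 0.
  move=> Pz tight; apply: etrans (vanish z (conv_hull_sub Pz) tight).
  by rewrite affine_coords.
have A0 i : (1 <= i <= T)%N -> entry wx^T (i - 1) = 0.
  exact: (A_eq0 Cl_ge0 Cl_Vb Vb_Cu V_gt0 Cl_Cu kt tT vanish dip0).
split; first exact: (alpha_eq0 Cl_ge0 Cl_Vb Vb_Cu V_gt0 kt tT vanish).
have -> : wx = 0.
  by apply: entry_eq0 => i iT; have := A0 i.+1; rewrite subn1; apply.
have -> : wy = 0.
  apply: entry_eq0 => i iT.
  have := B_eq0 Cl_ge0 Cl_Vb Vb_Cu V_gt0 Cl_Cu kt tT L_gt1 ramp_small
    ramp_large L_small vanish A0 (i := i.+1).
  by rewrite subn1; apply.
have -> : wu = 0.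
  apply: entry_eq0 => i iT.
  have := C_eq0 Cl_ge0 Cl_Vb Vb_Cu V_gt0 Cl_Cu kt tT k_le_L L_gt1 ramp_small
    ramp_large L_small vanish A0 (s := i.+2).
  by rewrite subn2; apply; clear -iT; lia.
by rewrite !col_mx0.
Qed.
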